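(* Let $\Gamma_1,\Gamma_2,\Gamma_3$ be three circles in the Euclidean plane with non-collinear centers $O_1,O_2,O_3$ and radii $r_1,r_2,r_3>0$ respectively, and let $O$ be the circumcenter of the triangle $O_1O_2O_3$. Indices are read modulo $3$, so $\Gamma_{i+3}=\Gamma_i$, $O_{i+3}=O_i$. Assume that for each $i\in\{1,2,3\}$ one has $P_{\Gamma_{i+2}}(O_i)\neq 0$ and $P_{\Gamma_{i+1}}(O_i)\neq P_{\Gamma_{i+2}}(O_i)$ (so that the objects below are defined). Assume that the points $M_{O_1}(\Gamma_2,\Gamma_3)$, $M_{O_2}(\Gamma_3,\Gamma_1)$, $M_{O_3}(\Gamma_1,\Gamma_2)$ are collinear. For $i=1,2,3$ let $l_i$ be the radical axis of $K_{O_{i+1}}(\Gamma_{i+2},\Gamma_{i+3})$ and $K_{O_{i+2}}(\Gamma_{i+3},\Gamma_{i+1})$. Then $l_1,l_2,l_3$ are the same line, and this line passes through $O$.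
   Context: For a circle $\Gamma$ with center $C$ and radius $r$ in the Euclidean plane and a point $X$, the power of $X$ with respect to $\Gamma$ is $P_\Gamma(X)=|CX|^2-r^2$. For circles $\Gamma,\Gamma'$ and a point $A$ with $P_{\Gamma'}(A)\neq 0$ and $P_{\Gamma}(A)\neq P_{\Gamma'}(A)$, put $k=P_{\Gamma}(A)/P_{\Gamma'}(A)\neq 1$. The Apollonius circle $K_A(\Gamma,\Gamma')$ is the set of points $X$ of the plane with $P_{\Gamma}(X)=k\,P_{\Gamma'}(X)$; it contains $A$ and is a circle, possibly degenerate to a single point, which is then regarded as a circle of radius $0$ centered at that point. Its center is denoted $M_A(\Gamma,\Gamma')$. The radical axis of two circles $K,K'$ (radius $0$ allowed) with distinct centers is the line consisting of all points $X$ with $P_{K}(X)=P_{K'}(X)$. *)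

(* Defs.v *)
From mathcomp Require Import all_boot all_order all_algebra.
From mathcomp Require Import boolp classical_sets reals.
From mathcomp Require Import ring.

Set Implicit Arguments.
Unset Strict Implicit.
Unset Printing Implicit Defensive.

Import Order.TTheory GRing.Theory Num.Theory.

Local Open Scope classical_set_scope.
Local Open Scope ring_scope.

Section Plane.
Variable R : realType.

Definition plane := 'rV[R]_2.

Implicit Types (X Y Z A C : plane) (L : set plane).

(* The library norm on row vectors is the sup norm, so the Euclidean distance
   is defined here. *)
Definition dist X Y : R := Num.sqrt (\sum_(i < 2) (X 0 i - Y 0 i) ^+ 2).

Lemma dist_sqr (X Y : plane) : dist X Y ^+ 2 = \sum_(i < 2) (X 0 i - Y 0 i) ^+ 2.
Proof. by rewrite sqr_sqrtr // sumr_ge0 // => i _; rewrite sqr_ge0. Qed.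

Definition is_line L : Prop :=
  exists (A v : plane), v != 0 /\ L = [set A + t *: v | t in [set: R]].

Definition collinear X Y Z : Prop :=
  exists L, [/\ is_line L, L X, L Y & L Z].

Definition is_circumcenter C X Y Z : Prop :=
  dist C X = dist C Y /\ dist C Y = dist C Z.

(* A circle is a (center, radius) pair; the sign of the radius is not built in,
   and is constrained wherever circles are used. *)
Definition circle := (plane * R)%type.
Definition center (K : circle) : plane := K.1.
Definition radius (K : circle) : R := K.2.

Definition circle_points (K : circle) : set plane :=
  [set X | dist (center K) X = radius K].

Definition power (K : circle) X : R := dist (center K) X ^+ 2 - radius K ^+ 2.

Definition apollonius_set A (G G' : circle) : set plane :=
  [set X | power G X = power G A / power G' A * power G' X].

(* The circle of radius >= 0 whose set of points is [apollonius_set A G G'].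
   [apollonius_circleP] shows that it exists under the standing assumptions on
   A, G, G'; the default value (0, 0) is never used then. *)
Definition apollonius_circle A (G G' : circle) : circle :=
  xget (0, 0) [set K | 0 <= radius K /\ circle_points K = apollonius_set A G G'].

Lemma apollonius_circleP (A : plane) (G G' : circle) :
  power G' A <> 0 -> power G A <> power G' A ->
  0 <= radius (apollonius_circle A G G') /\
  circle_points (apollonius_circle A G G') = apollonius_set A G G'.
Proof.
move=> /eqP p0 /eqP pne.
pose k := power G A / power G' A.
have k1 : 1 - k != 0.
  by rewrite subr_eq0 eq_sym; apply: contra pne => /eqP/divr1_eq ->.
pose C : plane := (1 - k)^-1 *: (center G - k *: center G').
have key X : power G X - k * power G' X =
    (1 - k) * (dist C X ^+ 2 - dist C A ^+ 2) + (power G A - k * power G' A).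
  rewrite /power !dist_sqr !big_ord_recl !big_ord0 !mxE.
  by field.
have kA : power G A - k * power G' A = 0 by rewrite divfK // subrr.
apply: (@xgetPex circle (0, 0)
  [set K | 0 <= radius K /\ circle_points K = apollonius_set A G G']).
exists (C, dist C A); split=> /=; first exact: sqrtr_ge0.
apply/seteqP; split=> X /=; rewrite /circle_points /apollonius_set /= -/k => h.
  by apply/eqP; rewrite -subr_eq0 key kA addr0 [dist C X]h subrr mulr0.
have /eqP := key X; rewrite h subrr kA addr0 eq_sym mulf_eq0 (negPf k1) /=.
by rewrite subr_eq0 eqrXn2 ?sqrtr_ge0 // => /eqP.
Qed.

Definition radical_axis (K K' : circle) : set plane :=
  [set X | power K X = power K' X].

End Plane.

Arguments plane R : clear implicits.
Arguments circle R : clear implicits.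

(* Main.v *)
Require Import Defs.
From mathcomp Require Import all_boot all_order all_algebra.
From mathcomp Require Import boolp classical_sets reals.
From mathcomp Require Import ring.

Import Order.TTheory GRing.Theory Num.Theory.

Local Open Scope ring_scope.

(** Put [P_i] for the power with respect to [G_i] and [a_ij] for [P_i(O_j)].
    The power with respect to [K_1] is [(a_31 P_2 - a_21 P_3) / (a_31 - a_21)], so
    [M_1] has barycentric coordinates [(0 : a_31 : - a_21)], and cyclically. As in Menelaus'
    theorem, the [M_i] are collinear iff [a_31 a_12 a_23 = a_21 a_32 a_13]. Both
    sides are then nonzero, so the [M_i] are pairwise distinct. Moreover the same
    identity, expanded in terms of the squared side lengths and radii, says that
    [O] has the same power with respect to all three [K_i]. Hence every [l_i] is
    the line through [O] perpendicular to the line of the [M_i]. *)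

(** * Circles in coordinates, and how their points determine them *)

Section PlaneGeometry.
Variable R : realType.
Implicit Types (A C X Y Z O v : plane R) (K G : circle R).

Lemma planeP X Y : X 0 0 = Y 0 0 -> X 0 1 = Y 0 1 -> X = Y.
Proof.
move=> h0 h1; apply/rowP => -[[|[|//]] lt_i].
  by rewrite (_ : Ordinal lt_i = 0) //; apply: val_inj.
by rewrite (_ : Ordinal lt_i = 1) //; apply: val_inj.
Qed.

Lemma dist_sqrE X Y :
  dist X Y ^+ 2 = (X 0 0 - Y 0 0) ^+ 2 + (X 0 1 - Y 0 1) ^+ 2.
Proof.
rewrite dist_sqr !big_ord_recl big_ord0 addr0.
by rewrite (_ : lift ord0 ord0 = 1) //; apply: val_inj.
Qed.

Lemma dist_ge0 X Y : 0 <= dist X Y.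
Proof. exact: sqrtr_ge0. Qed.

Lemma distC X Y : dist X Y = dist Y X.
Proof.
apply/eqP; rewrite -(@eqrXn2 _ 2) ?dist_ge0 // !dist_sqrE; apply/eqP; ring.
Qed.

Lemma circle_pointsE K X :
  0 <= radius K -> circle_points K X <-> power K X = 0.
Proof.
move=> r0; split=> [h|/eqP]; first by rewrite /power h subrr.
by rewrite subr_eq0 eqrXn2 ?dist_ge0 // => /eqP.
Qed.

Lemma circle_points_sub_center K K' : 0 < radius K -> 0 <= radius K' ->
  (circle_points K `<=` circle_points K')%classic -> center K = center K'.
Proof.
move: K K' => [C r] [C' r'] /= r0 r'0 sub.
pose e (x y : R) : plane R := \row_(i < 2) (if i == 0 then x else y).
have e0 x y : e x y 0 0 = x by rewrite mxE.
have e1 x y : e x y 0 1 = y by rewrite mxE.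
have pow_e x y : x ^+ 2 + y ^+ 2 = r ^+ 2 -> power (C', r') (C + e x y) = 0.
  move=> nu; apply/circle_pointsE => //; apply: sub; apply/circle_pointsE.
    exact: ltW.
  by rewrite /power dist_sqrE !mxE /= -nu; ring.
(* Subtracting the equations of two antipodal points on the same axis leaves
   [4 r] times a coordinate of [C - C']. *)
have := pow_e r 0; have := pow_e (- r) 0; have := pow_e 0 r.
have := pow_e 0 (- r); rewrite /power !dist_sqrE /=.
rewrite ![(_ + _ : 'M_(_, _)) _ _]mxE !e0 !e1 !sqrrN !expr0n !addr0 !add0r.
move=> /(_ erefl) h1 /(_ erefl) h2 /(_ erefl) h3 /(_ erefl) h4.
have r4 : 4 * r != 0 by rewrite mulf_neq0 ?gt_eqF.
apply: planeP; apply/eqP; rewrite -subr_eq0 -(inj_eq (mulfI r4)) mulr0; apply/eqP.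
  by rewrite -[RHS](subrr 0) -{1}h4 -h3; ring.
by rewrite -[RHS](subrr 0) -{1}h2 -h1; ring.
Qed.

(** If one radius is positive, the inclusion of point sets identifies the centers; if both vanish,
    the common point is each center. That point then gives the radii. This uniqueness pins down the
    circle chosen in [apollonius_circle]. *)
Lemma circle_points_eq K K' : 0 <= radius K -> 0 <= radius K' ->
  circle_points K = circle_points K' -> (circle_points K !=set0)%classic -> K = K'.
Proof.
move=> r0 r0' e [X hX].
suff eC : center K = center K'.
  rewrite [K]surjective_pairing [K']surjective_pairing; congr pair => //.
  by rewrite -[LHS]hX eC; change (circle_points K' X); rewrite -e.
have [rp|rn] := ltP 0 (radius K).
  by apply: circle_points_sub_center => // Y; rewrite e.
have [rp'|rn'] := ltP 0 (radius K').
  by apply/esym; apply: circle_points_sub_center => // Y; rewrite e.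
have center_eq K1 : radius K1 <= 0 -> 0 <= radius K1 ->
    circle_points K1 X -> center K1 = X.
  move=> rl rg /(circle_pointsE _ _ rg).
  rewrite /power dist_sqrE (_ : radius K1 = 0); last by apply/eqP; rewrite eq_le rl.
  rewrite expr0n subr0 => /eqP; rewrite paddr_eq0 ?sqr_ge0 //.
  by rewrite !sqrf_eq0 !subr_eq0 => /andP[/eqP ? /eqP ?]; apply: planeP.
by rewrite (center_eq K) // (center_eq K') // -e.
Qed.

(** * Explicit Apollonius circles *)

Lemma apollonius_circleE A G G' :
  power G' A <> 0 -> power G A <> power G' A ->
  let q := power G' A - power G A in
  let C := q^-1 *: (power G' A *: center G - power G A *: center G') in
  apollonius_circle A G G' = (C, dist C A).
Proof.
move=> p0 pne q C; have [r0 ptsE] := apollonius_circleP p0 pne.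
have q0 : q != 0 by rewrite subr_eq0 eq_sym; apply/eqP.
have p0' : power G' A != 0 by apply/eqP.
have ptsE' : circle_points (C, dist C A) = apollonius_set A G G'.
  (* Both sides have the same quadratic part in [X], the choice of [C] matches the linear parts, and
     both vanish at [A]. *)
  have key X : power G' A * power G X - power G A * power G' X =
      q * power (C, dist C A) X.
    rewrite /C; move: q0; rewrite /q /power !dist_sqrE !mxE /= => q0.
    by field.
  apply/seteqP; split=> X /=.
    move/circle_pointsE => /(_ (dist_ge0 _ _)) h.
    apply: (mulfI p0'); rewrite mulrA mulrCA divff // mulr1.
    by apply: subr0_eq; rewrite key h mulr0.
  move=> h; apply/circle_pointsE; first exact: dist_ge0.
  apply: (mulfI q0); rewrite -key h mulrA mulrCA divff //; ring.
apply: circle_points_eq => //=; first exact: dist_ge0.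
  by rewrite ptsE.
by exists A; rewrite ptsE /apollonius_set /= divfK.
Qed.

Lemma power_apollonius A G G' X :
  power G' A <> 0 -> power G A <> power G' A ->
  power (apollonius_circle A G G') X =
  (power G' A * power G X - power G A * power G' X) / (power G' A - power G A).
Proof.
move=> p0 pne; rewrite apollonius_circleE //.
have : power G' A - power G A != 0 by rewrite subr_eq0 eq_sym; apply/eqP.
rewrite /power !dist_sqrE /= !mxE => q0; by field.
Qed.

(** * Collinearity and radical axes *)

(** Twice the signed area of the triangle. *)
Definition orient X Y Z : R :=
  (Y 0 0 - X 0 0) * (Z 0 1 - X 0 1) - (Y 0 1 - X 0 1) * (Z 0 0 - X 0 0).

Lemma collinear_orient X Y Z : orient X Y Z = 0 -> collinear X Y Z.
Proof.
move=> D0.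
have line v s t : v != 0 -> Y = X + s *: v -> Z = X + t *: v -> collinear X Y Z.
  move=> v0 eY eZ; exists [set X + r *: v | r in [set: R]]%classic.
  split; first by exists X, v.
  - by exists 0 => //; rewrite scale0r addr0.
  - by exists s.
  - by exists t.
have [eZ|nZ] := eqVneq (Z - X) 0; last first.
  have [/eqP z0|z0] := eqVneq ((Z - X) 0 0) 0.
    have z1 : (Z - X) 0 1 != 0.
      apply: contra nZ => /eqP z1; apply/eqP/planeP; rewrite ?z1 ?(eqP z0) mxE //.
    apply: (line (Z - X) ((Y 0 1 - X 0 1) / (Z - X) 0 1) 1) => //.
      move: z0 z1 D0; rewrite /orient !mxE => /eqP z0 z1 D0.
      apply: planeP; rewrite !mxE; last by field.
      have /eqP := D0; rewrite z0 mulr0 subr0 mulf_eq0 (negPf z1) orbF => /eqP.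
      by move/subr0_eq ->; ring.
    by rewrite scale1r addrC subrK.
  apply: (line (Z - X) ((Y 0 0 - X 0 0) / (Z - X) 0 0) 1) => //.
    move: z0 D0; rewrite /orient !mxE => z0 D0.
    apply: planeP; rewrite !mxE; first by field.
    apply: (mulIf z0); apply/esym/subr0_eq; rewrite -{}[RHS]D0; by field.
  by rewrite scale1r addrC subrK.
have eZ' : Z = X by apply: subr0_eq.
have [eY|nY] := eqVneq (Y - X) 0.
  have eY' : Y = X by apply: subr0_eq.
  (* The three points coincide, so any nonzero direction will do. *)
  apply: (line (const_mx 1) 0 0); rewrite ?scale0r ?addr0 //.
  by apply/eqP => /matrixP/(_ 0 0)/eqP; rewrite !mxE oner_eq0.
apply: (line (Y - X) 1 0) => //; rewrite ?scale0r ?scale1r ?addr0 //.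
by rewrite addrC subrK.
Qed.

(** The vector [v] turned by a right angle. *)
Definition perp v : plane R := \row_(i < 2) (if i == 0 then - v 0 1 else v 0 0).

Lemma perp_neq0 v : v != 0 -> perp v != 0.
Proof.
apply: contra => /eqP/rowP h; apply/eqP/planeP; rewrite mxE.
  by have := h 1; rewrite !mxE.
by have := h 0; rewrite !mxE /= => /eqP; rewrite oppr_eq0 => /eqP.
Qed.

(** The difference of the two powers is affine with gradient along [v], and it vanishes at [O]. The
    resulting line does not depend on [s], [t] or the radii, which is why all three axes will
    agree. *)
Lemma radical_axisE K K' O A v s t : v != 0 -> s != t ->
  center K = A + s *: v -> center K' = A + t *: v -> power K O = power K' O ->
  radical_axis K K' = [set O + x *: perp v | x in [set: R]]%classic.
Proof.
move=> v0 st eC eC' eO.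
have key X : power K X - power K' X =
    2 * (t - s) * (v 0 0 * (X 0 0 - O 0 0) + v 0 1 * (X 0 1 - O 0 1)).
  transitivity ((power K X - power K' X) - (power K O - power K' O)).
    by rewrite eO subrr subr0.
  by rewrite /power !dist_sqrE eC eC' !mxE; ring.
have n0 : 2 * (t - s) != 0 by rewrite mulf_neq0 ?pnatr_eq0 // subr_eq0 eq_sym.
have nv0 : v 0 0 ^+ 2 + v 0 1 ^+ 2 != 0.
  rewrite paddr_eq0 ?sqr_ge0 // !sqrf_eq0; apply: contra v0.
  by move=> /andP[/eqP h0 /eqP h1]; apply/eqP/planeP; rewrite mxE.
apply/seteqP; split=> X /=; rewrite /radical_axis /=; last first.
  by move=> [x _ <-]; apply: subr0_eq; rewrite key !mxE /=; ring.
move=> e; have /eqP := key X; rewrite e subrr eq_sym mulf_eq0 (negPf n0) /=.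
move=> /eqP h.
(* The component of [X - O] along [perp v]; the error in each coordinate is a multiple of the
   orthogonality relation [h]. *)
exists ((v 0 0 * (X 0 1 - O 0 1) - v 0 1 * (X 0 0 - O 0 0)) /
        (v 0 0 ^+ 2 + v 0 1 ^+ 2)) => //.
apply: planeP; rewrite !mxE /=; apply: (mulIf nv0); apply/esym/subr0_eq.
  transitivity (v 0 0 * 0 : R); last exact: mulr0.
  by rewrite -h; field.
transitivity (v 0 1 * 0 : R); last exact: mulr0.
by rewrite -h; field.
Qed.

End PlaneGeometry.

Arguments orient {R}.
Arguments perp {R}.

(** * The Menelaus relation and the power of the circumcenter *)

(** Here [a], [b], [c] stand for the squared sides opposite [O1], [O2], [O3], the [s_i] for the
    squared radii and [rho] for the squared circumradius. After cross-multiplication [rho] cancels,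
    and the sides differ by exactly the defect of the product relation. *)
Lemma apollonius_power_eq (F : fieldType) (a b c s1 s2 s3 rho : F) :
  (b - s3) - (c - s2) != 0 -> (c - s1) - (a - s3) != 0 ->
  (b - s3) * (c - s1) * (a - s2) = (c - s2) * (a - s3) * (b - s1) ->
  ((b - s3) * (rho - s2) - (c - s2) * (rho - s3)) / ((b - s3) - (c - s2)) =
  ((c - s1) * (rho - s3) - (a - s3) * (rho - s1)) / ((c - s1) - (a - s3)).
Proof.
move=> n1 n2 /eqP; rewrite -subr_eq0 => /eqP h.
apply/eqP; rewrite eqr_div //; apply/eqP/subr0_eq; rewrite -h; ring.
Qed.

Section ThreeCircles.
Variable R : realType.
Variables (G1 G2 G3 : circle R).

Let O1 := center G1.
Let O2 := center G2.
Let O3 := center G3.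
Let K1 := apollonius_circle O1 G2 G3.
Let K2 := apollonius_circle O2 G3 G1.
Let K3 := apollonius_circle O3 G1 G2.

Hypothesis p31 : power G3 O1 <> 0.
Hypothesis p12 : power G1 O2 <> 0.
Hypothesis p23 : power G2 O3 <> 0.
Hypothesis q1 : power G2 O1 <> power G3 O1.
Hypothesis q2 : power G3 O2 <> power G1 O2.
Hypothesis q3 : power G1 O3 <> power G2 O3.

Lemma menelaus_apollonius : orient O1 O2 O3 != 0 ->
  orient (center K1) (center K2) (center K3) = 0 ->
  power G3 O1 * power G1 O2 * power G2 O3 =
  power G2 O1 * power G3 O2 * power G1 O3.
Proof.
move=> D0; rewrite /K1 /K2 /K3 !apollonius_circleE //=.
move: p31 p12 p23 q1 q2 q3 D0; rewrite -/O1 -/O2 -/O3.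
move: (power G3 O1) (power G2 O1) (power G1 O2) (power G3 O2)
  (power G2 O3) (power G1 O3) => a31 a21 a12 a32 a23 a13.
move=> _ _ _ /nesym/eqP; rewrite -subr_eq0 => n1.
move=> /nesym/eqP; rewrite -subr_eq0 => n2 /nesym/eqP; rewrite -subr_eq0 => n3.
move=> D0 h; apply: subr0_eq; apply: (mulIf D0); rewrite mul0r.
(* The area of the triangle of centers is that of [O1 O2 O3] times the determinant of the normalized
   barycentric coordinates; these factors are the normalizing denominators. *)
transitivity ((a31 - a21) * (a12 - a32) * (a23 - a13) * 0); last exact: mulr0.
by rewrite -h /orient !mxE; field; rewrite n1 n2 n3.
Qed.

(** The center of [K1] lies on the line [O2 O3], whereas that of [K2] does not: its barycentric
    coordinate at [O1] is a nonzero multiple of [power G3 O2]. *)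
Lemma center_apollonius_neq : orient O1 O2 O3 != 0 -> power G3 O2 != 0 ->
  center K1 != center K2.
Proof.
move=> D0; rewrite /K1 /K2 !apollonius_circleE //=.
move: p31 p12 q1 q2 D0; rewrite -/O1 -/O2 -/O3.
move: (power G3 O1) (power G2 O1) (power G1 O2) (power G3 O2) => a31 a21 a12 a32.
move=> _ _ /nesym/eqP; rewrite -subr_eq0 => n1.
move=> /nesym/eqP; rewrite -subr_eq0 => n2 D0 a0.
apply/eqP => e.
have : orient O2 O3 ((a31 - a21)^-1 *: (a31 *: O2 - a21 *: O3)) = 0.
  by rewrite /orient !mxE; field.
rewrite e => h; case/eqP: (mulf_neq0 a0 D0).
transitivity (- (a12 - a32) * 0); last exact: mulr0.
by rewrite -h /orient !mxE; field.
Qed.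

Lemma power_apollonius_circumcenter O :
  dist O O1 = dist O O2 -> dist O O2 = dist O O3 ->
  power G3 O1 * power G1 O2 * power G2 O3 =
  power G2 O1 * power G3 O2 * power G1 O3 ->
  power K1 O = power K2 O.
Proof.
move=> e12 e23; rewrite /K1 /K2 !power_apollonius //.
move: q1 q2 => /nesym/eqP; rewrite -subr_eq0 => n1.
move=> /nesym/eqP; rewrite -subr_eq0 => n2; move: n1 n2.
rewrite /power -/O1 -/O2 -/O3.
rewrite !(distC _ _ O) -{}e23 -{}e12 (distC _ O2 O1) (distC _ O3 O1) (distC _ O3 O2).
exact: apollonius_power_eq.
Qed.

End ThreeCircles.

(** * Coincidence of the three radical axes *)

Lemma apollonius_radical_axes (R : realType) (G1 G2 G3 : circle R) (O : plane R)
  (K1 := apollonius_circle (center G1) G2 G3)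
  (K2 := apollonius_circle (center G2) G3 G1)
  (K3 := apollonius_circle (center G3) G1 G2) :
  ~ collinear (center G1) (center G2) (center G3) ->
  is_circumcenter O (center G1) (center G2) (center G3) ->
  power G3 (center G1) <> 0 -> power G1 (center G2) <> 0 ->
  power G2 (center G3) <> 0 ->
  power G2 (center G1) <> power G3 (center G1) ->
  power G3 (center G2) <> power G1 (center G2) ->
  power G1 (center G3) <> power G2 (center G3) ->
  collinear (center K1) (center K2) (center K3) ->
  exists l : set (plane R),
    [/\ is_line l, radical_axis K1 K2 = l, radical_axis K2 K3 = l,
        radical_axis K3 K1 = l & l O].
Proof.
move=> ncol [e12 e23] p31 p12 p23 q1 q2 q3.
move=> [_ [[A [v [v0 ->]]] [t1 _ M1] [t2 _ M2] [t3 _ M3]]].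
have D1 : orient (center G1) (center G2) (center G3) != 0.
  by apply/eqP => D0; apply/ncol/collinear_orient.
(* The rotated forms allow the lemmas on [K1] and [K2] to be applied to the other two pairs. *)
have D2 : orient (center G2) (center G3) (center G1) != 0.
  by move: D1; congr (_ != 0); rewrite /orient; ring.
have D3 : orient (center G3) (center G1) (center G2) != 0.
  by move: D1; congr (_ != 0); rewrite /orient; ring.
have colK : orient (center K1) (center K2) (center K3) = 0.
  by rewrite -M1 -M2 -M3 /orient !mxE; ring.
have men := menelaus_apollonius _ _ _ _ p31 p12 p23 q1 q2 q3 D1 colK.
(* The hypotheses make the factors on one side of [men] nonzero; the relation carries this to the
   other side, as distinctness of the centers requires. *)
have : power G2 (center G1) * power G3 (center G2) * power G1 (center G3) != 0.
  by rewrite -men !mulf_neq0 //; apply/eqP.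
rewrite !mulf_eq0 !negb_or -andbA => /and3P[a21 a32 a13].
have N12 : center K1 != center K2 by apply: center_apollonius_neq.
have N23 : center K2 != center K3 by apply: center_apollonius_neq.
have N31 : center K3 != center K1 by apply: center_apollonius_neq.
have P12 : power K1 O = power K2 O by apply: power_apollonius_circumcenter.
have P23 : power K2 O = power K3 O.
  apply: power_apollonius_circumcenter => //; first by rewrite -e23.
  by rewrite mulrC mulrA men; ring.
exists [set O + x *: perp v | x in [set: R]]%classic; split.
- by exists O, (perp v); split=> //; apply: perp_neq0.
- apply: (@radical_axisE _ _ _ _ A v t1 t2) => //.
  by apply: contra N12 => /eqP e; rewrite -M1 -M2 e.
- apply: (@radical_axisE _ _ _ _ A v t2 t3) => //.
  by apply: contra N23 => /eqP e; rewrite -M2 -M3 e.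
- apply: (@radical_axisE _ _ _ _ A v t3 t1) => //; last by rewrite P12.
  by apply: contra N31 => /eqP e; rewrite -M3 -M1 e.
- by exists 0 => //; rewrite scale0r addr0.
Qed.

(* Indices live in 'Z_3, so that 3 = 0. *)
Theorem theorem2p5 (R : realType) (G : 'Z_3 -> circle R) (O : plane R)
  (radius_gt0 : forall i : 'Z_3, 0 < radius (G i))
  (ncol : ~ collinear (center (G 1)) (center (G 2)) (center (G 3)))
  (circO : is_circumcenter O (center (G 1)) (center (G 2)) (center (G 3)))
  (pow_neq0 : forall i : 'Z_3, power (G (i + 2)) (center (G i)) <> 0)
  (pow_neq : forall i : 'Z_3,
     power (G (i + 1)) (center (G i)) <> power (G (i + 2)) (center (G i)))
  (colM : collinear
     (center (apollonius_circle (center (G 1)) (G 2) (G 3)))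
     (center (apollonius_circle (center (G 2)) (G 3) (G 1)))
     (center (apollonius_circle (center (G 3)) (G 1) (G 2)))) :
  exists l : set (plane R),
    [/\ is_line l,
        forall i : 'Z_3,
          radical_axis
            (apollonius_circle (center (G (i + 1))) (G (i + 2)) (G (i + 3)))
            (apollonius_circle (center (G (i + 2))) (G (i + 3)) (G (i + 1)))
          = l
      & l O].
Proof.
(* The residue 0 is written as 3, to match the indices in the hypotheses. *)
have e1 (k : 'Z_3) : k = 1 \/ k = 2 \/ k = 3.
  by case: k => [[|[|[|//]]] lt_k]; [right; right|left|right; left]; apply: val_inj.
have z3 : (3 : 'Z_3) = 0 by apply: val_inj.
have z11 : (1 + 1 : 'Z_3) = 2 by apply: val_inj.
have z12 : (1 + 2 : 'Z_3) = 3 by apply: val_inj.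
have z13 : (1 + 3 : 'Z_3) = 1 by apply: val_inj.
have z21 : (2 + 1 : 'Z_3) = 3 by apply: val_inj.
have z22 : (2 + 2 : 'Z_3) = 1 by apply: val_inj.
have z23 : (2 + 3 : 'Z_3) = 2 by apply: val_inj.
have z31 : (3 + 1 : 'Z_3) = 1 by apply: val_inj.
have z32 : (3 + 2 : 'Z_3) = 2 by apply: val_inj.
have z33 : (3 + 3 : 'Z_3) = 3 by apply: val_inj.
have p1 := pow_neq0 1; have p2 := pow_neq0 2; have p3 := pow_neq0 3.
have q1 := pow_neq 1; have q2 := pow_neq 2; have q3 := pow_neq 3.
rewrite z12 in p1; rewrite z22 in p2; rewrite z32 in p3.
rewrite z11 z12 in q1; rewrite z21 z22 in q2; rewrite z31 z32 in q3.
have [l [lineL l12 l23 l31 lO]] :=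
  apollonius_radical_axes _ _ _ _ _ ncol circO p1 p2 p3 q1 q2 q3 colM.
exists l; split=> // i; have [->|[->|->]] := e1 i.
- by rewrite z11 z12 z13.
- by rewrite z21 z22 z23.
- by rewrite z31 z32 z33.
Qed.
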